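(* Let $n$ be a positive integer, and let $a_1 \leq a_2 \leq \cdots$ be a nondecreasing sequence of positive integers such that \[ \frac{1}{n} = \sum_{i=1}^{\infty} \frac{1}{a_i}, \] and such that $a_i \neq s_i(n)$ for some index $i$. Then \[ \liminf_{i\to\infty} a_i^{2^{-i}} < c_n . \]
   Context: For a positive integer $n$, the generalized Sylvester sequence $(s_i(n))_{i\ge 1}$ is defined by $s_1(n) = n+1$ and $s_{i+1}(n) = s_i(n)^2 - s_i(n) + 1$ for $i \geq 1$ (for $n=1$ this is the ordinary Sylvester sequence $2,3,7,43,\dots$). The limit $\lim_{i\to\infty} s_i(n)^{2^{-i}}$ exists, and $c_n$ denotes this limit. *)

(* Defs.v *)
From Stdlib Require Import Reals Lra Lia.
From Coquelicot Require Import Coquelicot.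
Open Scope R_scope.

(* Sequences indexed by i = 1, 2, ... in the mathematics are indexed from 0
   here: [sylvester n k] is s_{k+1}(n).  The truncated subtraction is harmless
   because every term is positive. *)
Fixpoint sylvester (n k : nat) : nat :=
  match k with
  | O => n + 1
  | S k' => let s := sylvester n k' in s ^ 2 - s + 1
  end%nat.

(* [root_seq a k] is a_{k+1} ^ (2 ^ -(k+1)), where a_{k+1} = [a k]; [Rpower] is
   the real power as soon as its base is positive. *)
Definition root_seq (a : nat -> nat) (k : nat) : R :=
  Rpower (INR (a k)) (/ 2 ^ S k).

(* [Lim_seq] is total; [is_lim_c] shows that the limit does exist. *)
Definition c (n : nat) : R := real (Lim_seq (root_seq (sylvester n))).

Lemma sylvester_pos (n k : nat) : (0 < sylvester n k)%nat.
Proof. destruct k; simpl; lia. Qed.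

Lemma is_lim_c (n : nat) : is_lim_seq (root_seq (sylvester n)) (Finite (c n)).
Proof.
  apply Lim_seq_correct'.
  apply ex_finite_lim_seq_decr with (M := 0).
  - intros k; unfold root_seq.
    pose proof (sylvester_pos n k) as Hk.
    apply lt_INR in Hk; simpl INR in Hk.
    assert (H2 : 0 < 2 ^ S k) by (apply pow_lt; lra).
    replace (/ 2 ^ S k) with (INR 2 * / 2 ^ S (S k))
      by (simpl; simpl in H2; field; lra).
    rewrite <- Rpower_mult, Rpower_pow by assumption.
    apply Rle_Rpower_l.
    + left; apply Rinv_0_lt_compat, pow_lt; lra.
    + split; [apply lt_0_INR, sylvester_pos |].
      rewrite <- pow_INR; apply le_INR.
      pose proof (sylvester_pos n k).
      cbn [sylvester]; cbv zeta; rewrite Nat.pow_2_r; nia.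
  - intros k; unfold root_seq, Rpower; left; apply exp_pos.
Qed.

(* Main.v *)
(** If some prefix product [n a_1 ... a_k] is smaller than the Sylvester one,
    the remainder [1/n - (1/a_1 + ... + 1/a_k)], a multiple of
    [1 / (n a_1 ... a_k)], is too large.  Otherwise all prefix products dominate
    those of the Sylvester sequence, and an Abel summation based on
    [ln x <= x - 1] shows that the sum of the [1/a_i] is below [1/n] unless the
    two sequences agree.  Applied to [a], this yields an index [k] where
    [N = n a_1 ... a_k] is smaller than the Sylvester product; applied to the
    tails of [a], it shows that the products of [a] stay, infinitely often,
    below those of the Sylvester sequence restarted from [N], which grows with
    a base strictly below [c n].  At such indices the remainder is too large for
    the remaining terms to grow with a base close to [c n]. *)

Require Import Defs.
From Stdlib Require Import Reals Lra Lia Classical.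
From Coquelicot Require Import Coquelicot.
Open Scope R_scope.

(** * Prefix products and the Sylvester recurrence *)

(** The initial factor [N] is a parameter so that a tail of a sequence, started from an earlier
    product, is treated like the whole sequence. *)
Fixpoint prefix_prod (N : nat) (b : nat -> nat) (m : nat) : nat :=
  match m with
  | O => N
  | S k => prefix_prod N b k * b k
  end%nat.

Lemma prefix_prod_pos (N : nat) (b : nat -> nat) (m : nat) :
  (1 <= N)%nat -> (forall i, (1 <= b i)%nat) -> (1 <= prefix_prod N b m)%nat.
Proof.
  intros HN Hb; induction m as [|m IH]; simpl; [exact HN|].
  specialize (Hb m); nia.
Qed.

Lemma prefix_prod_add (N : nat) (b : nat -> nat) (k j : nat) :
  prefix_prod N b (k + j) =
  prefix_prod (prefix_prod N b k) (fun i => b (k + i)%nat) j.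
Proof.
  induction j as [|j IH]; [now rewrite Nat.add_0_r|].
  rewrite Nat.add_succ_r; simpl; now rewrite IH.
Qed.

Lemma sylvester_ge_1 (N k : nat) : (1 <= sylvester N k)%nat.
Proof. apply sylvester_pos. Qed.

(** Induction on s^2 - s + 1 = (s - 1) s + 1. *)
Lemma sylvester_prefix_prod (N k : nat) :
  sylvester N k = (prefix_prod N (sylvester N) k + 1)%nat.
Proof.
  induction k as [|k IH]; [reflexivity|].
  cbn [sylvester prefix_prod]; cbv zeta; rewrite IH, Nat.pow_2_r; nia.
Qed.

Lemma sylvester_prod_S (N k : nat) :
  prefix_prod N (sylvester N) (S k) =
  (prefix_prod N (sylvester N) k * (prefix_prod N (sylvester N) k + 1))%nat.
Proof. cbn [prefix_prod]; now rewrite sylvester_prefix_prod. Qed.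

(** Both sides iterate the increasing map P -> P (P + 1). *)
Lemma sylvester_prod_le (N M i j : nat) :
  (N <= prefix_prod M (sylvester M) j)%nat ->
  (prefix_prod N (sylvester N) i <= prefix_prod M (sylvester M) (j + i))%nat.
Proof.
  intros H; induction i as [|i IH]; [now rewrite Nat.add_0_r|].
  rewrite Nat.add_succ_r, !sylvester_prod_S; nia.
Qed.

(** Telescoping: 1/(P + 1) = 1/P - 1/(P (P + 1)). *)
Lemma sum_inv_sylvester (N m : nat) : (1 <= N)%nat ->
  sum_n (fun i => / INR (sylvester N i)) m =
  / INR N - / INR (prefix_prod N (sylvester N) (S m)).
Proof.
  intros HN.
  assert (Hpos : forall k, 0 < INR (prefix_prod N (sylvester N) k)).
  { intros k; apply (lt_INR 0), prefix_prod_pos; [exact HN|apply sylvester_ge_1]. }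
  assert (Hstep : forall k, / INR (sylvester N k) =
    / INR (prefix_prod N (sylvester N) k)
    - / INR (prefix_prod N (sylvester N) (S k))).
  { intros k; specialize (Hpos k).
    rewrite sylvester_prod_S, sylvester_prefix_prod, mult_INR, plus_INR.
    simpl INR; field; lra. }
  induction m as [|m IH].
  - rewrite sum_O; apply Hstep.
  - rewrite sum_Sn, IH, (Hstep (S m)); unfold plus; simpl; ring.
Qed.

(** * Comparison of reciprocal sums, and remainders *)

(** Summation by parts leaves, besides the left side, the nonnegative terms (w_i - w_{i+1})
    D_{i+1}. *)
Lemma abel_sum_lower (w d D : nat -> R) (m : nat) :
  D 0%nat = 0 -> (forall k, D (S k) = D k + d k) -> (forall k, 0 <= D k) ->
  (forall k, w (S k) <= w k) ->
  w m * D (S m) <= sum_n (fun i => w i * d i) m.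
Proof.
  intros HD0 HDS HD Hw; induction m as [|m IH].
  - rewrite sum_O, HDS, HD0; lra.
  - rewrite sum_Sn; unfold plus; simpl.
    rewrite (HDS (S m)); specialize (HD (S m)); specialize (Hw m); nra.
Qed.

Lemma ln_lt_sub_1 (x : R) : 0 < x -> x <> 1 -> ln x < x - 1.
Proof.
  intros Hx Hx1.
  assert (H : ln x <> 0).
  { intros H; apply Hx1; rewrite <- (exp_ln x Hx), H; apply exp_0. }
  apply exp_ineq1 in H; rewrite exp_ln in H by exact Hx; lra.
Qed.

(** This is ln x < x - 1 at x = b/t, divided by b. *)
Lemma inv_sub_lower (b t : R) : 0 < b -> 0 < t -> b <> t ->
  / b * (ln b - ln t) < / t - / b.
Proof.
  intros Hb Ht Hne.
  assert (Hbt : 0 < b / t) by now apply Rdiv_lt_0_compat.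
  assert (Hne1 : b / t <> 1).
  { intros H; apply Hne; replace b with (b / t * t) by (field; lra); rewrite H; ring. }
  pose proof (ln_lt_sub_1 _ Hbt Hne1) as H.
  rewrite ln_div in H by assumption.
  apply Rmult_lt_compat_l with (r := / b) in H; [|now apply Rinv_0_lt_compat].
  replace (/ t - / b) with (/ b * (b / t - 1)) by (field; lra); exact H.
Qed.

(** A gap independent of [m] keeps the inequality strict in the limit. *)
Lemma sum_inv_gap (N : nat) (b t : nat -> nat) (j : nat) :
  (1 <= N)%nat -> (forall i, (1 <= b i)%nat) -> (forall i, (1 <= t i)%nat) ->
  (forall i, (b i <= b (S i))%nat) ->
  (forall m, (prefix_prod N t m <= prefix_prod N b m)%nat) ->
  b j <> t j ->
  exists eps, 0 < eps /\ forall m, (j <= m)%nat ->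
    sum_n (fun i => / INR (b i)) m + eps <= sum_n (fun i => / INR (t i)) m.
Proof.
  intros HN Hb Ht Hmono Hdom Hj.
  assert (Hb' : forall i, 0 < INR (b i)) by (intros i; apply (lt_INR 0), Hb).
  assert (Ht' : forall i, 0 < INR (t i)) by (intros i; apply (lt_INR 0), Ht).
  assert (HPb : forall m, 0 < INR (prefix_prod N b m))
    by (intros m; apply (lt_INR 0), prefix_prod_pos; assumption).
  assert (HPt : forall m, 0 < INR (prefix_prod N t m))
    by (intros m; apply (lt_INR 0), prefix_prod_pos; assumption).
  (* The slack in [inv_sub_lower]: never negative, and positive at [j], which yields the gap. *)
  set (e := fun i => / INR (t i) - / INR (b i)
                     - / INR (b i) * (ln (INR (b i)) - ln (INR (t i)))).
  assert (He : forall i, 0 <= e i).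
  { intros i; unfold e; destruct (Nat.eq_dec (b i) (t i)) as [E|E].
    - rewrite E; lra.
    - assert (H := inv_sub_lower (INR (b i)) (INR (t i)) (Hb' i) (Ht' i)
                     (not_INR _ _ E)); lra. }
  exists (e j); split.
  { unfold e; assert (H := inv_sub_lower (INR (b j)) (INR (t j)) (Hb' j) (Ht' j)
                             (not_INR _ _ Hj)); lra. }
  intros m Hm.
  assert (Hge : forall k, (j <= k)%nat -> e j <= sum_n e k).
  { assert (Hnn : forall k, 0 <= sum_n e k).
    { induction k as [|k IH]; [rewrite sum_O; apply He|].
      rewrite sum_Sn; unfold plus; simpl; specialize (He (S k)); lra. }
    induction k as [|k IH]; intros Hk.
    - replace j with 0%nat by lia; rewrite sum_O; lra.
    - rewrite sum_Sn; unfold plus; simpl.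
      destruct (Nat.eq_dec j (S k)) as [->|E].
      + specialize (Hnn k); lra.
      + specialize (IH ltac:(lia)); specialize (He (S k)); lra. }
  specialize (Hge m Hm).
  assert (Habel := abel_sum_lower (fun i => / INR (b i))
    (fun i => ln (INR (b i)) - ln (INR (t i)))
    (fun k => ln (INR (prefix_prod N b k)) - ln (INR (prefix_prod N t k))) m).
  cbv beta in Habel.
  assert (HD : forall k,
    0 <= ln (INR (prefix_prod N b k)) - ln (INR (prefix_prod N t k))).
  { intros k; enough (ln (INR (prefix_prod N t k)) <= ln (INR (prefix_prod N b k))) by lra.
    apply ln_le; [apply HPt|apply le_INR, Hdom]. }
  (* Abel summation with the decreasing weights 1/b_i; D is the logarithm of the ratio of the prefix
     products, nonnegative by domination. *)
  assert (Hsum : 0 <= sum_n (fun i => / INR (b i) * (ln (INR (b i)) - ln (INR (t i)))) m).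
  { eapply Rle_trans; [|apply Habel].
    - apply Rmult_le_pos; [left; apply Rinv_0_lt_compat, Hb'|apply HD].
    - simpl; ring.
    - intros k; cbn [prefix_prod]; rewrite !mult_INR, !ln_mult; auto; ring.
    - exact HD.
    - intros k; apply Rinv_le_contravar; [apply Hb'|apply le_INR, Hmono]. }
  assert (Heq : sum_n (fun i => / INR (b i)) m + sum_n e m
    + sum_n (fun i => / INR (b i) * (ln (INR (b i)) - ln (INR (t i)))) m
    = sum_n (fun i => / INR (t i)) m).
  { clear; induction m as [|m IH].
    - rewrite !sum_O; unfold e; ring.
    - rewrite !sum_Sn, <- IH; unfold plus; simpl; unfold e; ring. }
  lra.
Qed.

(** A disagreement would keep the sum at least eps below 1/N. Only a lower bound on [r] is assumed,
    which is what is known for remainders. *)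
Lemma sylvester_of_dominating (N : nat) (b : nat -> nat) (r : R) :
  (1 <= N)%nat -> (forall i, (1 <= b i)%nat) ->
  (forall i, (b i <= b (S i))%nat) ->
  is_series (fun i => / INR (b i)) r -> / INR N <= r ->
  (forall m, (prefix_prod N (sylvester N) m <= prefix_prod N b m)%nat) ->
  forall i, b i = sylvester N i.
Proof.
  intros HN Hb Hmono Hser Hr Hdom j.
  destruct (Nat.eq_dec (b j) (sylvester N j)) as [E|E]; [exact E|exfalso].
  destruct (sum_inv_gap N b (sylvester N) j HN Hb (sylvester_ge_1 N) Hmono Hdom E)
    as [eps [Heps Hgap]].
  assert (Hle : Rbar_le r (/ INR N - eps)).
  { apply is_lim_seq_le_loc with (u := sum_n (fun i => / INR (b i)))
      (v := fun _ => / INR N - eps); [|exact Hser|apply is_lim_seq_const].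
    exists j; intros m Hm; specialize (Hgap m Hm).
    rewrite (sum_inv_sylvester N m HN) in Hgap.
    assert (0 < / INR (prefix_prod N (sylvester N) (S m))); [|lra].
    apply Rinv_0_lt_compat, (lt_INR 0), prefix_prod_pos;
      [exact HN|apply sylvester_ge_1]. }
  simpl in Hle; lra.
Qed.

(* The remainder after [k] terms is a positive integer multiple of the inverse
   of [prefix_prod n a k]. *)
Lemma series_tail_lower (n : nat) (a : nat -> nat) (k : nat) :
  (1 <= n)%nat -> (forall i, (1 <= a i)%nat) ->
  is_series (fun i => / INR (a i)) (/ INR n) ->
  exists r : R, is_series (fun i => / INR (a (k + i)%nat)) r /\
    / INR (prefix_prod n a k) <= r.
Proof.
  intros Hn Ha Hser.
  assert (Ha' : forall i, 0 < INR (a i)) by (intros i; apply (lt_INR 0), Ha).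
  assert (HP : forall m, 0 < INR (prefix_prod n a m))
    by (intros m; apply (lt_INR 0), prefix_prod_pos; assumption).
  (* The multiplier lives in [Z], since the induction alone gives no sign; positivity of [r] then
     forces z >= 1. *)
  assert (H : exists r : R, is_series (fun i => / INR (a (k + i)%nat)) r /\
    exists z : Z, r = IZR z * / INR (prefix_prod n a k)).
  { induction k as [|k [r [Hr [z Hz]]]].
    - exists (/ INR n); split; [exact Hser|exists 1%Z; simpl; ring].
    - exists (r - / INR (a k)); split.
      + apply is_series_ext with (fun i => / INR (a (k + S i)%nat)).
        { intros i; do 3 f_equal; lia. }
        apply (is_series_incr_1 (fun i => / INR (a (k + i)%nat))).
        unfold plus; simpl; rewrite Nat.add_0_r.
        now replace (r - / INR (a k) + / INR (a k)) with r by ring.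
      + exists (z * Z.of_nat (a k) - Z.of_nat (prefix_prod n a k))%Z.
        rewrite minus_IZR, mult_IZR, <- !INR_IZR_INZ, Hz; cbn [prefix_prod].
        rewrite mult_INR; specialize (HP k); specialize (Ha' k); field; lra. }
  destruct H as [r [Hr [z Hz]]]; exists r; split; [exact Hr|].
  assert (Hrpos : 0 < r).
  { assert (Hle : Rbar_le (/ INR (a k)) r).
    { apply is_lim_seq_le with (u := fun _ => / INR (a k))
        (v := sum_n (fun i => / INR (a (k + i)%nat)));
        [|apply is_lim_seq_const|exact Hr].
      intros m; induction m as [|m IH].
      - rewrite sum_O, Nat.add_0_r; lra.
      - rewrite sum_Sn; unfold plus; simpl.
        assert (0 < / INR (a (k + S m)%nat)) by apply Rinv_0_lt_compat, Ha'; lra. }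
    simpl in Hle; specialize (Ha' k); apply Rinv_0_lt_compat in Ha'; lra. }
  assert (HPi : 0 < / INR (prefix_prod n a k)) by apply Rinv_0_lt_compat, HP.
  assert (Hz1 : 1 <= IZR z).
  { apply IZR_le; enough (0 < z)%Z by lia; apply lt_IZR.
    rewrite Hz in Hrpos; nra. }
  nra.
Qed.

(** * Indices where the products of [a] are small *)

Lemma exists_smaller_prefix_prod (n : nat) (a : nat -> nat) :
  (1 <= n)%nat -> (forall i, (1 <= a i)%nat) -> (forall i, (a i <= a (S i))%nat) ->
  is_series (fun i => / INR (a i)) (/ INR n) ->
  (exists i, a i <> sylvester n i) ->
  exists k, (prefix_prod n a k < prefix_prod n (sylvester n) k)%nat.
Proof.
  intros Hn Ha Hmono Hser [i Hi].
  apply NNPP; intros Hno; apply Hi.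
  apply (sylvester_of_dominating n a (/ INR n)); auto; [lra|].
  intros m; apply Nat.nlt_ge; intros H; apply Hno; now exists m.
Qed.

Lemma last_true (Q : nat -> Prop) (K : nat) :
  Q 0%nat -> (forall j, (K <= j)%nat -> ~ Q j) ->
  exists j, Q j /\ forall i, (j < i)%nat -> ~ Q i.
Proof.
  intros H0; induction K as [|K IH]; intros HK.
  - now destruct (HK 0%nat (le_n _)).
  - destruct (classic (Q K)) as [H|H].
    + exists K; split; [exact H|intros i Hi; apply HK; lia].
    + apply IH; intros j Hj.
      destruct (Nat.eq_dec j K) as [->|E]; [exact H|apply HK; lia].
Qed.

(** If this failed, there would be a last good index [j] (0 is good, with equality). Restarted from
    the product [M] reached there, the tail would strictly dominate the Sylvester products of [M],
    while its sum, at least 1/M, forces it to be that very sequence. *)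
Lemma prefix_prod_small_infinitely_often (n : nat) (a : nat -> nat) (k K : nat) :
  (1 <= n)%nat -> (forall i, (1 <= a i)%nat) -> (forall i, (a i <= a (S i))%nat) ->
  is_series (fun i => / INR (a i)) (/ INR n) ->
  let N := prefix_prod n a k in
  exists j, (K <= j)%nat /\
    (prefix_prod n a (k + j) <= prefix_prod N (sylvester N) j)%nat.
Proof.
  intros Hn Ha Hmono Hser N.
  apply NNPP; intros Hno.
  destruct (last_true
    (fun j => (prefix_prod n a (k + j) <= prefix_prod N (sylvester N) j)%nat) K)
    as [j [Hj Hlast]].
  - rewrite Nat.add_0_r; apply le_n.
  - intros j Hj H; apply Hno; now exists j.
  - set (M := prefix_prod n a (k + j)) in *.
    assert (Hgt : forall i, (prefix_prod M (sylvester M) (S i) <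
       prefix_prod M (fun i => a (k + j + i)%nat) (S i))%nat).
    { intros i; unfold M at 3; rewrite <- prefix_prod_add.
      apply Nat.le_lt_trans with (prefix_prod N (sylvester N) (j + S i)).
      - now apply sylvester_prod_le.
      - apply Nat.nle_gt; rewrite <- Nat.add_assoc; apply Hlast; lia. }
    destruct (series_tail_lower n a (k + j) Hn Ha Hser) as [r [Hr Hrge]].
    assert (HM : (1 <= M)%nat) by now apply prefix_prod_pos.
    assert (Heq := sylvester_of_dominating M (fun i => a (k + j + i)%nat) r HM).
    cbv beta in Heq.
    specialize (Hgt 0%nat) as Hgt0; cbn [prefix_prod] in Hgt0.
    rewrite Heq in Hgt0; auto; [lia| |].
    + intros i; rewrite Nat.add_succ_r; apply Hmono.
    + intros [|i]; [apply le_n|apply Nat.lt_le_incl, Hgt].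
Qed.

(** * Doubly exponential growth and the constant [c n] *)

(** Induction on P (P + 1) + 1 <= (P + 1)^2. *)
Lemma sylvester_prod_upper (N j : nat) :
  (prefix_prod N (sylvester N) j + 1 <= (N + 1) ^ (2 ^ j))%nat.
Proof.
  induction j as [|j IH]; [simpl; lia|].
  rewrite sylvester_prod_S, Nat.pow_succ_r', (Nat.mul_comm 2), Nat.pow_mul_r,
    Nat.pow_2_r; nia.
Qed.

(** Each step at least squares the product: P (P + 1) >= P^2. *)
Lemma sylvester_prod_lower (n k i : nat) :
  (prefix_prod n (sylvester n) k ^ (2 ^ i) <= sylvester n (k + i))%nat.
Proof.
  rewrite sylvester_prefix_prod.
  enough (prefix_prod n (sylvester n) k ^ (2 ^ i)
          <= prefix_prod n (sylvester n) (k + i))%nat by lia.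
  induction i as [|i IH]; [rewrite Nat.add_0_r; simpl; lia|].
  rewrite Nat.add_succ_r, sylvester_prod_S, Nat.pow_succ_r', (Nat.mul_comm 2),
    Nat.pow_mul_r, Nat.pow_2_r; nia.
Qed.

Lemma Rpower_pow_root (x : R) (k i : nat) : 0 < x ->
  Rpower (x ^ (2 ^ i)) (/ 2 ^ (k + i)) = Rpower x (/ 2 ^ k).
Proof.
  intros Hx; rewrite <- Rpower_pow, Rpower_mult, pow_INR by exact Hx.
  f_equal; rewrite pow_add; change (INR 2) with 2; field.
  split; apply pow_nonzero; lra.
Qed.

Lemma Rpower_root_lt (x y : R) (k : nat) : 0 < x -> x < y ->
  Rpower x (/ 2 ^ k) < Rpower y (/ 2 ^ k).
Proof.
  intros Hx Hxy; apply Rlt_Rpower_l; [|lra].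
  apply Rinv_0_lt_compat, pow_lt; lra.
Qed.

(** Taking roots in [sylvester_prod_lower] bounds every later term of [root_seq] below by the same
    constant, hence also the limit. *)
Lemma c_lower (n k : nat) : (1 <= n)%nat ->
  Rpower (INR (prefix_prod n (sylvester n) k)) (/ 2 ^ S k) <= c n.
Proof.
  intros Hn.
  assert (Hpos : 0 < INR (prefix_prod n (sylvester n) k)).
  { apply (lt_INR 0), prefix_prod_pos; [exact Hn|apply sylvester_ge_1]. }
  apply (is_lim_seq_le
    (fun _ => Rpower (INR (prefix_prod n (sylvester n) k)) (/ 2 ^ S k))
    (fun i => root_seq (sylvester n) (i + k))
    (Finite (Rpower (INR (prefix_prod n (sylvester n) k)) (/ 2 ^ S k)))
    (Finite (c n))).
  - intros i; unfold root_seq.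
    rewrite <- (Rpower_pow_root _ (S k) i Hpos).
    replace (S (i + k)) with (S k + i)%nat by lia.
    apply Rle_Rpower_l.
    + left; apply Rinv_0_lt_compat, pow_lt; lra.
    + split; [now apply pow_lt|].
      rewrite <- pow_INR, (Nat.add_comm i k); apply le_INR, sylvester_prod_lower.
  - apply is_lim_seq_const.
  - apply (is_lim_seq_incr_n (root_seq (sylvester n)) k), is_lim_c.
Qed.

Lemma eventually_gt_of_lt_LimInf (u : nat -> R) (x y : R) :
  Rbar_le y (LimInf_seq u) -> x < y ->
  exists K, forall k, (K <= k)%nat -> x < u k.
Proof.
  intros Hle Hxy.
  pose proof (proj2_sig (ex_LimInf_seq u)) as H; fold (LimInf_seq u) in H.
  destruct (LimInf_seq u) as [l| |]; simpl in Hle, H.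
  - assert (Heps : 0 < l - x) by lra.
    destruct (H (mkposreal _ Heps)) as [_ [K HK]]; exists K; intros k Hk.
    specialize (HK k Hk); simpl in HK; lra.
  - destruct (H x) as [K HK]; now exists K.
  - contradiction.
Qed.

(** * Upper bound for the remainder and final contradiction *)

(** For x >= 2, x^(2^i) >= x 2^i, so the geometric series of sum 2/x dominates. *)
Lemma series_inv_upper (x r : R) (b : nat -> R) :
  2 <= x -> (forall i, x ^ (2 ^ i) <= b i) -> is_series (fun i => / b i) r ->
  r <= 2 / x.
Proof.
  intros Hx Hb Hser.
  assert (Hg : forall i, x * 2 ^ i <= x ^ (2 ^ i)).
  { induction i as [|i IH]; [simpl; lra|].
    rewrite Nat.pow_succ_r', (Nat.mul_comm 2), pow_mult.
    assert (H1 : 1 <= 2 ^ i) by (apply pow_R1_Rle; lra).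
    rewrite <- tech_pow_Rmult, <- Rsqr_pow2; unfold Rsqr.
    assert (2 <= x ^ (2 ^ i)) by nra; nra. }
  assert (Hsum : forall m, sum_n (fun i => / b i) m <= 2 / x - / (x * 2 ^ m)).
  { assert (Hi : forall i, / b i <= / (x * 2 ^ i)).
    { intros i; apply Rinv_le_contravar.
      - apply Rmult_lt_0_compat; [lra|apply pow_lt; lra].
      - eapply Rle_trans; [apply Hg|apply Hb]. }
    induction m as [|m IH].
    - rewrite sum_O; specialize (Hi 0%nat); simpl in *.
      rewrite Rmult_1_r in *; unfold Rdiv; lra.
    - rewrite sum_Sn; unfold plus; simpl plus; specialize (Hi (S m)).
      assert (H2 : 0 < 2 ^ m) by (apply pow_lt; lra).
      assert (E : / (x * 2 ^ m) = 2 * / (x * 2 ^ S m)) by (simpl; field; lra).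
      simpl in *; lra. }
  assert (Hle : Rbar_le r (2 / x)); [|exact Hle].
  apply is_lim_seq_le with (u := sum_n (fun i => / b i)) (v := fun _ => 2 / x);
    [|exact Hser|apply is_lim_seq_const].
  intros m; specialize (Hsum m).
  assert (0 < / (x * 2 ^ m)); [|lra].
  apply Rinv_0_lt_compat, Rmult_lt_0_compat; [lra|apply pow_lt; lra].
Qed.

Theorem theorem2p6 (n : nat) (a : nat -> nat)
    (hn : (1 <= n)%nat)
    (a_pos : forall i : nat, (1 <= a i)%nat)
    (a_nondecr : forall i j : nat, (i <= j)%nat -> (a i <= a j)%nat)
    (a_sum : is_series (fun i : nat => / INR (a i)) (/ INR n))
    (a_ne : exists i : nat, a i <> sylvester n i) :
  Rbar_lt (LimInf_seq (root_seq a)) (Finite (c n)).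
Proof.
  assert (Hmono : forall i, (a i <= a (S i))%nat)
    by (intros i; apply a_nondecr; lia).
  destruct (exists_smaller_prefix_prod n a hn a_pos Hmono a_sum a_ne) as [k Hk].
  apply Rbar_not_le_lt; intros Hle.
  assert (HN : (1 <= prefix_prod n a k)%nat) by now apply prefix_prod_pos.
  set (N := prefix_prod n a k) in *.
  set (u := prefix_prod n (sylvester n) k) in *.
  assert (Hu : 2 <= INR u) by (apply (le_INR 2); lia).
  (* [u ^ 2 < (u + 1/4) ^ 2 < u * (u + 1)], the next Sylvester product. *)
  set (d := INR u + / 4).
  assert (Hdc : Rpower d (/ 2 ^ S k) < c n).
  { eapply Rlt_le_trans; [|apply (c_lower n (S k) hn)].
    rewrite <- (Rpower_pow_root d (S k) 1) by (unfold d; lra).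
    rewrite Nat.add_1_r; apply Rpower_root_lt.
    - apply pow_lt; unfold d; lra.
    - rewrite sylvester_prod_S; fold u.
      rewrite mult_INR, plus_INR; unfold d; simpl; nra. }
  destruct (eventually_gt_of_lt_LimInf _ _ _ Hle Hdc) as [K HK].
  (* [root_seq a (k + j)] is a root of order 2^(k+j+1), so exceeding the root of [d] of order
     2^(k+1) means a_(k+j) > d^(2^j). *)
  assert (Hgrow : forall j, (K <= j)%nat -> d ^ (2 ^ j) <= INR (a (k + j)%nat)).
  { intros j Hj; specialize (HK (k + j)%nat ltac:(lia)); unfold root_seq in HK.
    apply Rnot_lt_le; intros Hlt.
    apply Rpower_root_lt with (k := (S k + j)%nat) in Hlt;
      [|apply (lt_INR 0), a_pos].
    rewrite Rpower_pow_root in Hlt by (unfold d; lra).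
    change (S k + j)%nat with (S (k + j)) in Hlt; lra. }
  (* Bernoulli: [(d / u) ^ (2 ^ j) >= 2] as soon as [2 ^ j >= 4 u]. *)
  destruct (prefix_prod_small_infinitely_often n a k (K + 4 * u) hn a_pos Hmono a_sum)
    as [j [HjK Hj]]; fold N in Hj.
  destruct (series_tail_lower n a (k + j) hn a_pos a_sum) as [r [Hr Hrge]].
  assert (Hd2 : 2 * INR u ^ (2 ^ j) <= d ^ (2 ^ j)).
  { replace d with (INR u * (1 + / (4 * INR u))) by (unfold d; field; lra).
    rewrite Rpow_mult_distr, Rmult_comm; apply Rmult_le_compat_l.
    - apply pow_le; lra.
    - assert (Hb : 0 < / (4 * INR u)) by (apply Rinv_0_lt_compat; lra).
      eapply Rle_trans; [|apply poly; exact Hb].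
      assert (Hpow : (4 * u <= 2 ^ j)%nat)
        by (pose proof (Nat.pow_gt_lin_r 2 j ltac:(lia)); lia).
      apply le_INR in Hpow; rewrite mult_INR in Hpow; simpl (INR 4) in Hpow.
      assert (1 = 4 * INR u * / (4 * INR u)) by (field; lra).
      simpl in *; nra. }
  assert (Hu1 : 1 <= INR u ^ (2 ^ j)) by (apply pow_R1_Rle; lra).
  assert (Hub : 2 <= d ^ (2 ^ j)) by lra.
  (* The growth bound reads (d^(2^j))^(2^i) <= a_(k+j+i), so r <= 2 / d^(2^j). *)
  apply (series_inv_upper (d ^ (2 ^ j)) r) in Hr; [|exact Hub|].
  2:{ intros i; rewrite <- pow_mult, <- Nat.pow_add_r, <- Nat.add_assoc.
      apply Hgrow; lia. }
  (* Integrality turns N < u into N + 1 <= u, the base in [sylvester_prod_upper]. *)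
  assert (Hlt : INR (prefix_prod n a (k + j)) < INR u ^ (2 ^ j)).
  { rewrite <- pow_INR; apply lt_INR.
    pose proof (sylvester_prod_upper N j) as H.
    assert ((N + 1) ^ (2 ^ j) <= u ^ (2 ^ j))%nat by (apply Nat.pow_le_mono_l; lia).
    lia. }
  assert (Hpp : 0 < INR (prefix_prod n a (k + j)))
    by (apply (lt_INR 0), prefix_prod_pos; assumption).
  (* Contradiction: r >= 1/(n a_1 ... a_(k+j)) > 1/u^(2^j) >= 2/d^(2^j) >= r. *)
  apply Rinv_lt_contravar in Hlt; [|apply Rmult_lt_0_compat; lra].
  apply Rinv_le_contravar in Hd2; [|lra].
  rewrite Rinv_mult in Hd2; unfold Rdiv in Hr; lra.
Qed.
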